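(* Let $(\mathcal{X},\mathcal{B},\mu)$ be a probability space and let $\mathcal{E}\colon \mathrm{Dom}(\mathcal{E})\times\mathrm{Dom}(\mathcal{E})\to\mathbb{R}$ be a symmetric nonnegative definite bilinear form satisfying Assumption A (see context). Suppose that the modified log-Sobolev inequality holds with constant $\rho_0>0$: $$\rho_0\,\mathrm{Ent}_\mu(f)\le \mathcal{E}(f,\log f)\quad\text{for all nonnegative } f\in\mathrm{Dom}(\mathcal{E}) \text{ with } \log f\in\mathrm{Dom}(\mathcal{E}).$$ For $p\in(1,2]$ and $\theta\in(0,1)$ denote $$k(p,\theta)=\Bigl(1-\frac{2\bigl((1+\theta)^p-1\bigr)}{p(p-1)(1-\theta)^2}\Bigr)\cdot\frac{\theta^{p-1}}{e^{p-1}(1+\theta)^{p-1}},\qquad K_p=\max\Bigl\{1-\frac1p;\ \frac p2\sup_{\theta\in(0,1)}k(p,\theta)\Bigr\}.$$ Then for every $p\in(1,2]$ the Beckner inequality $$\alpha_p\bigl(\mu(f^p)-\mu(f)^p\bigr)\le \frac p2\,\mathcal{E}(f,f^{p-1})\quad\text{for all nonnegative } f\in\mathrm{Dom}(\mathcal{E}) \text{ with } f^{p-1}\in\mathrm{Dom}(\mathcal{E})$$ holds with a constant $\alpha_p\ge K_p\rho_0$. Moreover, $\lim_{p\to1^+}K_p=\lim_{p\to2^-}K_p=1/2$ and $\inf_{p\in(1,2]}K_p\ge 0.17$. In particular the Beckner inequality holds with $\alpha_p\ge\rho_0/6$ for every $p\in(1,2]$.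
   Context: $L_0(\mathcal{X},\mu)$ is the space of $\mathcal{B}$-measurable real functions on $\mathcal{X}$; $\mathrm{Dom}(\mathcal{E})$ is a linear subspace of $L_0(\mathcal{X},\mu)$. Notation: $\mu(f)=\int_{\mathcal{X}} f\,d\mu$; $\mathrm{Ent}_\mu(f)=\mu(f\log f)-\mu(f)\log\mu(f)$ for $f\ge0$. Assumption A: (1) if $\varphi\colon\mathbb{R}\to\mathbb{R}$ is a contraction (1-Lipschitz) and $f\in\mathrm{Dom}(\mathcal{E})$, then $\varphi\circ f\in\mathrm{Dom}(\mathcal{E})$; (2) for any $f_1,f_2,g_1,g_2\in\mathrm{Dom}(\mathcal{E})$, if $(f_1(x)-f_1(y))(f_2(x)-f_2(y))\le (g_1(x)-g_1(y))(g_2(x)-g_2(y))$ for all $x,y\in\mathcal{X}$, then $\mathcal{E}(f_1,f_2)\le\mathcal{E}(g_1,g_2)$. Convention: an estimate $A\le B$ means ''if $B<\infty$, then $A$ is well-defined and the inequality holds''; in particular functional inequalities assert that their left-hand sides are well-defined. *)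

(* Defs.v *)
From HB Require Import structures.
From mathcomp Require Import all_boot all_order all_algebra.
From mathcomp Require Import all_classical all_reals all_analysis.
Import Order.TTheory GRing.Theory Num.Theory.
Import numFieldNormedType.Exports.

Set Implicit Arguments.
Unset Strict Implicit.
Unset Printing Implicit Defensive.

Local Open Scope classical_set_scope.
Local Open Scope ring_scope.

Section form.
Context {d : measure_display} {X : measurableType d} {R : realType}.
Implicit Types (Dom : set (X -> R)) (E : (X -> R) -> (X -> R) -> R).

(* Elements of L_0 are genuine functions, not classes modulo null sets: the
   comparison axiom below is a pointwise condition on them.
   A form is a total function E of which only the values on Dom x Dom are
   constrained or used. *)
Record nonneg_symmetric_form Dom E : Prop := {
  dom_measurable : forall f, Dom f -> measurable_fun setT f ;
  dom_subspace : submod_closed (fun f => f \in Dom) ;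
  form_linearl : forall a f g h, Dom f -> Dom g -> Dom h ->
    E (a *: f + g) h = a * E f h + E g h ;
  form_linearr : forall a f g h, Dom f -> Dom g -> Dom h ->
    E h (a *: f + g) = a * E h f + E h g ;
  form_symmetric : forall f g, Dom f -> Dom g -> E f g = E g f ;
  form_ge0 : forall f, Dom f -> 0 <= E f f
}.

Definition contraction_closed Dom : Prop :=
  forall phi : R -> R, 1.-lipschitz phi ->
  forall f, Dom f -> Dom (phi \o f).

Definition comparison Dom E : Prop :=
  forall f1 f2 g1 g2, Dom f1 -> Dom f2 -> Dom g1 -> Dom g2 ->
  (forall x y, (f1 x - f1 y) * (f2 x - f2 y) <= (g1 x - g1 y) * (g2 x - g2 y)) ->
  E f1 f2 <= E g1 g2.

Definition assumptionA Dom E : Prop :=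
  contraction_closed Dom /\ comparison Dom E.

End form.

Section inequalities.
Context {d : measure_display} {X : measurableType d} {R : realType}.
Variable mu : probability X R.
Implicit Types (Dom : set (X -> R)) (E : (X -> R) -> (X -> R) -> R).

Local Open Scope ereal_scope.

(* Expectations are taken in the extended reals, where +oo - +oo is given the
   value -oo; [a +? - b] says that [a - b] is not of this undefined form. *)

(* ln 0 = 0 and 0 * -oo = 0, hence the usual convention 0 log 0 = 0. *)
Definition Ent (f : X -> R) : \bar R :=
  'E_mu[fun x => (f x * ln (f x))%R] - 'E_mu[f] * lne 'E_mu[f].

Definition Ent_def (f : X -> R) : bool :=
  'E_mu[fun x => (f x * ln (f x))%R] +? - ('E_mu[f] * lne 'E_mu[f]).

Definition beckner_deficit (p : R) (f : X -> R) : \bar R :=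
  'E_mu[fun x => (f x `^ p)%R] - 'E_mu[f] `^ p.

Definition beckner_deficit_def (p : R) (f : X -> R) : bool :=
  'E_mu[fun x => (f x `^ p)%R] +? - ('E_mu[f] `^ p).

(* In both inequalities the right-hand side is always finite, so that the
   left-hand side has to be well defined.
   log f is real valued only if f is everywhere positive; as ln 0 = 0, this
   has to be required explicitly. *)
Definition mlsi Dom E (rho : R) : Prop :=
  forall f, Dom f -> (forall x, (0 < f x)%R) -> Dom (fun x => ln (f x)) ->
  Ent_def f /\ rho%:E * Ent f <= (E f (fun x => ln (f x)))%:E.

Definition beckner Dom E (p alpha : R) : Prop :=
  forall f, Dom f -> (forall x, (0 <= f x)%R) ->
  Dom (fun x => (f x `^ (p - 1))%R) ->
  beckner_deficit_def p f /\
  alpha%:E * beckner_deficit p f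
    <= (p / 2 * E f (fun x => f x `^ (p - 1)))%:E.

End inequalities.

Section constants.
Context {R : realType}.

Definition kfun (p theta : R) : R :=
  (1 - (2 * ((1 + theta) `^ p - 1)) / (p * (p - 1) * (1 - theta) ^+ 2)) *
  (theta `^ (p - 1) / (expR (p - 1) * (1 + theta) `^ (p - 1))).

Definition Kbeckner (p : R) : R :=
  Num.max (1 - p^-1) (p / 2 * sup [set kfun p theta | theta in `]0, 1[%classic]).

End constants.

(* Main.v *)
Require Import Defs.
From mathcomp Require Import all_boot all_order all_algebra.
From mathcomp Require Import all_classical all_reals all_analysis.
From mathcomp Require Import measurable_realfun ring lra.
Import Order.TTheory GRing.Theory Num.Theory.
Import numFieldNormedType.Exports.

Local Open Scope classical_set_scope.
Local Open Scope ring_scope.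

(** Beckner's inequality in fact holds with the constant [rho0 / 2] for every
    [p], and [Kbeckner p <= 1 / 2].

    Write [s = p - 1].  For [s < 1], since [x ^ s] is, up to a constant, the integral of
    [u ^ (s - 1) ln (1 + x / u)] over [u > 0], it suffices to integrate the
    inequalities [E (f, ln (f + u)) = E (f + u, ln (f + u)) >= rho0 Ent (f + u)].
    The entropy is [mu (g (f + u)) - g (mu f + u)] with [g t = t ln t], so it
    involves the law of [f] only through an integral and through the mean, and
    integrating [g'' (x + u) = 1 / (x + u)] against [u ^ (s - 1)] gives back
    [x ^ (s - 1)].  Jensen's inequality then yields
    [E (f, f ^ s) >= (rho0 / p) (mu (f ^ p) - (mu f) ^ p)].

    As [E] only commutes with finite sums, the integral is replaced by a finite
    combination of [1 / (x + u_j)] which is within a factor [l] of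
    [x ^ (s - 1)] on a compact interval, with [l > 1] arbitrary (for [s = 1] one
    term with a large [u_0] suffices); truncation and monotone convergence remove the restriction to such an interval. *)

(** * Mean values, tangents of convex functions, geometric decay *)

Section calculus.
Context {R : realType}.
Implicit Types (F dF : R -> R) (a b x y : R).

Lemma mean_value F dF a b : a <= b ->
  (forall x, a <= x <= b -> is_derive x 1 F (dF x)) ->
  exists2 c, a <= c <= b & F b - F a = dF c * (b - a).
Proof.
move=> ab dFx.
have [||c] := @MVT_segment R F dF a b ab.
- by move=> x; rewrite in_itv/= => /andP[ax xb]; apply: dFx; rewrite !ltW.
- apply: derivable_within_continuous => x; rewrite in_itv/= => xab.
  by have [] := dFx _ xab.
by rewrite in_itv/=; exists c.
Qed.

Lemma tangent_le F dF a b m x :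
  (forall x, a <= x <= b -> is_derive x 1 F (dF x)) ->
  (forall x y, a <= x -> x <= y -> y <= b -> dF x <= dF y) ->
  a <= m <= b -> a <= x <= b -> F m + dF m * (x - m) <= F x.
Proof.
move=> dFx ndF /andP[am mb] /andP[ax xb]; have [mx|/ltW xm] := leP m x.
- have [|c /andP[mc cx] E] := mean_value F dF m x mx.
    by move=> y /andP[my yx]; apply: dFx; rewrite (le_trans am my) (le_trans yx xb).
  rewrite -lerBrDl E ler_wpM2r ?subr_ge0//.
  by apply: ndF => //; exact: le_trans xb.
- have [|c /andP[xc cm] E] := mean_value F dF x m xm.
    by move=> y /andP[xy ym]; apply: dFx; rewrite (le_trans ax xy) (le_trans ym mb).
  rewrite -lerBrDl -lerN2 -mulrN !opprB E ler_wpM2r ?subr_ge0//.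
  by apply: ndF => //; exact: le_trans xc.
Qed.

Lemma exp_small (q e : R) : 0 <= q < 1 -> 0 < e ->
  exists N, forall n, (N <= n)%N -> q ^+ n <= e.
Proof.
move=> /andP[q0 q1] e0.
have : q ^+ n @[n --> \oo] --> 0 by apply: cvg_expr; rewrite ger0_norm.
move=> /cvgrPdist_le /(_ _ e0)[N _ HN]; exists N => n /HN.
by rewrite sub0r normrN ger0_norm// exprn_ge0.
Qed.

End calculus.

(** * Approximation of [x ^ (s - 1)] by finite sums of [c / (x + u)] *)

Section stieltjes.
Context {R : realType}.
Implicit Types (a b e k r s t u x y : R).

(** For [0 < s < 1] its integral against [du / u] does not depend on [x]: this is the Stieltjes
    formula for [x ^ (s - 1)]. The kernel is homogeneous of degree 0, and a geometric grid in [u]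
    discretises [du / u]. *)
Let ker s u x : R := u `^ s * x `^ (1 - s) / (x + u).

Let ker_ge0 s u x : 0 < u -> 0 < x -> 0 <= ker s u x.
Proof. by move=> u0 x0; rewrite divr_ge0 ?mulr_ge0 ?powR_ge0 ?addr_ge0 ?ltW. Qed.

Let ker_scale s k u x : 0 < k -> 0 < u -> 0 < x ->
  ker s (k * u) (k * x) = ker s u x.
Proof.
move=> k0 u0 x0; rewrite /ker !powRM ?ltW// -mulrDr mulrACA -powRD; last first.
  by rewrite (gt_eqF k0) implybT.
by rewrite addrC subrK powRr1 ?ltW// -mulf_div divff ?mul1r// gt_eqF.
Qed.

(** From [x] to [y] the numerator grows by a factor at most [r ^ (1 - s) <= r], while the
    denominator only increases. *)
Let ker_le s r u x y : 0 <= s <= 1 -> 1 <= r -> 0 < u -> 0 < x ->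
  x <= y -> y <= r * x -> ker s u y <= r * ker s u x.
Proof.
move=> /andP[s0 s1] r1 u0 x0 xy yr; have y0 := lt_le_trans x0 xy.
have r0 : 0 < r by exact: lt_le_trans r1.
rewrite /ker mulrA ler_pM ?invr_ge0 ?mulr_ge0 ?powR_ge0 ?addr_ge0 ?(ltW u0) ?(ltW y0)//.
- rewrite mulrCA ler_wpM2l ?powR_ge0//.
  apply: (@le_trans _ _ ((r * x) `^ (1 - s))).
    by rewrite ge0_ler_powR ?subr_ge0// nnegrE ltW ?mulr_gt0.
  by rewrite powRM ?(ltW r0) ?(ltW x0)// ler_wpM2r ?powR_ge0// ler1_powR// gerBl.
- by rewrite lef_pV2 ?posrE ?addr_gt0// lerD2r.
Qed.

(** The numerator increases from [x] to [y], and [y + u <= r * (x + u)]. *)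
Let ker_ge s r u x y : 0 <= s <= 1 -> 1 <= r -> 0 < u -> 0 < x ->
  x <= y -> y <= r * x -> ker s u x <= r * ker s u y.
Proof.
move=> /andP[s0 s1] r1 u0 x0 xy yr; have y0 := lt_le_trans x0 xy.
rewrite /ker [r * _]mulrCA ler_pM ?invr_ge0 ?mulr_ge0 ?powR_ge0 ?addr_ge0 ?(ltW u0) ?(ltW x0)//.
- rewrite ler_wpM2l ?powR_ge0// ge0_ler_powR ?subr_ge0// nnegrE ltW//.
- rewrite -[X in _ <= X]invrK invfM invrK lef_pV2 ?posrE ?addr_gt0 ?mulr_gt0
    ?invr_gt0 ?(lt_le_trans _ r1)//.
  rewrite ler_pdivrMl ?(lt_le_trans _ r1)//.
  by rewrite mulrDr lerD// ler_peMl// ltW.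
  by rewrite addr_gt0.
Qed.

Section grid.
Variables (s r u0 : R).
Hypotheses (s01 : 0 <= s <= 1) (r1 : 1 < r) (u00 : 0 < u0).

Let r0 : 0 < r. Proof. exact: lt_trans r1. Qed.
Let ur0 j : 0 < u0 * r ^+ j. Proof. by rewrite mulr_gt0 ?exprn_gt0. Qed.

Let sig m n x : R := \sum_(m <= j < n) ker s (u0 * r ^+ j) x.

Let sig_le m n m' n' x : 0 < x -> (m' <= m)%N -> (n <= n')%N -> sig m n x <= sig m' n' x.
Proof.
move=> x0 mm nn; have [mn|/ltnW nm] := leqP m n; last first.
  by rewrite /sig big_geq// sumr_ge0// => j _; exact: ker_ge0.
rewrite /sig (big_cat_nat mm (leq_trans mn nn))/= (big_cat_nat mn nn)/=.
by rewrite addrCA lerDl addr_ge0// sumr_ge0// => j _; exact: ker_ge0.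
Qed.

Let sig_shift m n x : 0 < x -> sig m.+1 n.+1 (r * x) = sig m n x.
Proof.
move=> x0; rewrite /sig big_add1/=; apply: eq_bigr => j _.
by rewrite exprS mulrCA ker_scale.
Qed.

(** Dividing [y] by [r] moves the window down one node at no cost. Once [y] lies between [x] and
    [r * x], a termwise comparison costs the factor [r], which is thus paid only once. *)
Let sig_up m n (k : nat) x y : 0 < x -> x <= y -> y <= r ^+ k * x ->
  sig (m + k) (n + k) y <= r * sig m (n + k) x.
Proof.
move=> x0; elim: k y => [|k IH] y xy yk.
  rewrite !addn0; have -> : y = x by apply/le_anti; rewrite xy andbT -[x]mul1r.
  by rewrite ler_peMl ?(ltW r1)// /sig sumr_ge0// => j _; rewrite ker_ge0.
have y0 := lt_le_trans x0 xy.
have [yr|/ltW yr] := leP y (r * x).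
  apply: (@le_trans _ _ (r * sig (m + k.+1) (n + k.+1) x)).
    by rewrite /sig mulr_sumr ler_sum// => j _; apply: ker_le; rewrite // ltW.
  by rewrite ler_wpM2l ?sig_le ?leq_addr// ltW.
rewrite !addnS -[y](@mulVKf _ r) ?gt_eqF// sig_shift ?mulr_gt0 ?invr_gt0//.
apply: (@le_trans _ _ (r * sig m (n + k) x)).
  apply: IH; first by rewrite ler_pdivlMl.
  by rewrite ler_pdivrMl// mulrA -exprS.
by rewrite ler_wpM2l ?sig_le// ltW.
Qed.

(** The same induction, now dividing the larger point [x] by [r]; each step extends its window
    upwards by one node. *)
Let sig_down m n (k : nat) x y : 0 < y -> y <= x -> x <= r ^+ k * y ->
  sig m n y <= r * sig m (n + k) x.
Proof.
move=> y0; elim: k m n x => [|k IH] m n x yx xk.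
  rewrite !addn0; have -> : y = x by apply/le_anti; rewrite yx/= -[y]mul1r.
  by rewrite ler_peMl ?(ltW r1)// /sig sumr_ge0// => j _; rewrite ker_ge0 ?(lt_le_trans y0 yx).
have x0 := lt_le_trans y0 yx.
have [xr|/ltW xr] := leP x (r * y).
  apply: (@le_trans _ _ (r * sig m n x)).
    by rewrite /sig mulr_sumr ler_sum// => j _; apply: ker_ge; rewrite // ltW.
  by rewrite ler_wpM2l ?sig_le ?leq_addr// ltW.
apply: (@le_trans _ _ (r * sig m (n + k) (r^-1 * x))).
  apply: IH; first by rewrite ler_pdivlMl.
  by rewrite ler_pdivrMl// mulrA -exprS.
rewrite -sig_shift ?mulr_gt0 ?invr_gt0// mulVKf ?gt_eqF//.
by rewrite ler_wpM2l ?sig_le ?addnS// ltW.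
Qed.

(* Multiplying [x] by [r] shifts the grid by one node, and the kernel varies by
   a factor at most [r] between [x] and [r x]. *)
Lemma grid_comparable m n (k : nat) x y : 0 < x -> 0 < y ->
  y <= r ^+ k * x -> x <= r ^+ k * y ->
  \sum_(m + k <= j < n + k) ker s (u0 * r ^+ j) y <=
  r * \sum_(m <= j < n + k + k) ker s (u0 * r ^+ j) x.
Proof.
move=> x0 y0 yx xy; have [le_xy|/ltW le_yx] := leP x y.
- apply: le_trans (sig_up m n k x y x0 le_xy yx) _.
  by rewrite ler_wpM2l ?sig_le ?leq_addr// ltW.
- apply: le_trans (sig_down (m + k) (n + k) k x y y0 le_yx xy) _.
  by rewrite ler_wpM2l ?sig_le ?leq_addr// ltW.
Qed.

End grid.

Let ker_a s r a M j : 0 < a -> 0 < r ->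
  ker s (a / r ^+ M * r ^+ j) a = (r ^+ j / r ^+ M) `^ s / (1 + r ^+ j / r ^+ M).
Proof.
move=> a0 r0; rewrite -mulrA [r ^- M * _]mulrC -{2}[a]mulr1 ker_scale//.
  by rewrite /ker powR1/= mulr1.
by rewrite divr_gt0 ?exprn_gt0.
Qed.

(** At [a] the kernel is [v ^ s / (1 + v)] with [v = u / a]. It is at most [v ^ s], which is small
    for nodes far below [M]. *)
Let ker_low s r a M d j : 0 <= s -> 0 < a -> 1 < r -> (j + d <= M)%N ->
  ker s (a / r ^+ M * r ^+ j) a <= (r^-1 `^ s) ^+ d.
Proof.
move=> s0 a0 r1 jd; have r0 : 0 < r by exact: lt_trans r1.
rewrite ker_a//; set v := r ^+ j / _.
have v0 : 0 < v by rewrite divr_gt0 ?exprn_gt0.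
apply: (@le_trans _ _ (v `^ s)).
  rewrite ler_pdivrMr ?addr_gt0// ler_peMr ?powR_ge0//.
  by rewrite lerDl ltW.
rewrite -powR_mulrn ?powR_ge0// powRAC powR_mulrn ?invr_ge0 ?(ltW r0)//.
rewrite ge0_ler_powR ?nnegrE ?(ltW v0) ?exprn_ge0 ?invr_ge0 ?(ltW r0)//.
rewrite /v ler_pdivrMr ?exprn_gt0// exprVn ler_pdivlMl ?exprn_gt0//.
by rewrite -exprD ler_weXn2l ?(ltW r1)// addnC.
Qed.

(** Far above [M] the relevant bound is [v ^ s / (1 + v) <= v ^ (s - 1)]. *)
Let ker_high s r a M d j : s <= 1 -> 0 < a -> 1 < r -> (M + d <= j)%N ->
  ker s (a / r ^+ M * r ^+ j) a <= (r^-1 `^ (1 - s)) ^+ d.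
Proof.
move=> s1 a0 r1 jd; have r0 : 0 < r by exact: lt_trans r1.
rewrite ker_a//; set v := r ^+ j / _.
have v0 : 0 < v by rewrite divr_gt0 ?exprn_gt0.
apply: (@le_trans _ _ (v^-1 `^ (1 - s))).
  rewrite ler_pdivrMr ?addr_gt0// -powR_inv1 ?(ltW v0)// -powRrM mulN1r opprB.
  rewrite mulrDr mulr1 -[leLHS]add0r lerD ?powR_ge0//.
  by rewrite -[in X in _ * X](powRr1 (ltW v0)) -powRD ?subrK// (gt_eqF v0) implybT.
rewrite -powR_mulrn ?powR_ge0// powRAC powR_mulrn ?invr_ge0 ?(ltW r0)//.
rewrite ge0_ler_powR ?subr_ge0 ?nnegrE ?exprn_ge0 ?invr_ge0 ?(ltW r0) ?(ltW v0)//.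
rewrite exprVn lef_pV2 ?posrE ?exprn_gt0//.
by rewrite /v ler_pdivlMr ?exprn_gt0// -exprD ler_weXn2l ?(ltW r1)// addnC.
Qed.

Let sum_le_const (F : nat -> R) m n (e : R) : (forall j, (m <= j < n)%N -> F j <= e) ->
  \sum_(m <= j < n) F j <= (n - m)%:R * e.
Proof.
move=> Fe; rewrite [leRHS]mulrC mulr_natr -sumr_const_nat.
by apply: ler_sum_nat => j jmn; exact: Fe.
Qed.

(** The grid sum at [x] is compared with sums at [a] over windows with [K] nodes fewer or more at
    each end. Of the three factors [1 + e], two come from the lower and the upper comparison and one
    from the boundary nodes. *)
Lemma stieltjes_grid s a b e : 0 < s < 1 -> 0 < a -> a <= b -> 0 < e ->
  exists n (c u : nat -> R),
  [/\ forall j, 0 < c j, forall j, 0 < u j &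
      forall x, a <= x <= b ->
      1 <= x `^ (1 - s) * \sum_(j < n) c j / (x + u j) <= (1 + e) ^+ 3].
Proof.
move=> /andP[s0 s1] a0 ab e0.
have b0 := lt_le_trans a0 ab.
pose r := 1 + e; have r1 : 1 < r by rewrite ltrDl.
have r0 : 0 < r by exact: lt_trans r1.
have V01 : 0 <= r^-1 < 1 by rewrite invr_ge0 (ltW r0)/= invf_lt1.
have pow01 (t : R) : 0 < t -> 0 <= r^-1 `^ t < 1.
  move=> t0; rewrite powR_ge0/=.
  have : r^-1 `^ t < 1 `^ t.
    by case/andP: V01 => ? ?; rewrite gt0_ltr_powR ?nnegrE.
  by rewrite powR1.
have [K /(_ K (leqnn K)) HK] := exp_small r^-1 (a / b) V01 (divr_gt0 a0 b0).
have {}HK : b <= r ^+ K * a.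
  move: HK; rewrite exprVn ler_pdivlMr// mulrC ler_pdivrMr ?exprn_gt0//.
  by rewrite mulrC.
(* The two tails of [2 K] nodes add at most [4 K e1 <= e / 2], hence at most [e * V] since
   [V >= 1 / 2]. *)
pose e1 : R := e / (8 * K%:R + 8).
have e10 : 0 < e1 by rewrite divr_gt0// ltr_pwDr// mulr_ge0.
have [N1 HN1] := exp_small _ _ (pow01 s s0) e10.
have s1' : 0 < 1 - s by rewrite subr_gt0.
have [N2 HN2] := exp_small _ _ (pow01 _ s1') e10.
(* Node [M] lies at [u = a], where the kernel at [a] is [1 / 2]. It belongs to the central window
   from [2 K] to [L], and every node outside this window is at least [d] steps from it. *)
pose d := maxn N1 N2; pose M := (K + K + d)%N; pose L := (M + d).+1.
have {}HN1 := HN1 d (leq_maxl _ _); have {}HN2 := HN2 d (leq_maxr _ _).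
pose u0 := a / r ^+ M; have u00 : 0 < u0 by rewrite divr_gt0 ?exprn_gt0.
have u0r j : 0 < u0 * r ^+ j by rewrite mulr_gt0 ?exprn_gt0.
pose V := \sum_(K + K <= j < L) ker s (u0 * r ^+ j) a.
have KKM : (K + K <= M)%N by rewrite leq_addr.
have ML : (M < L)%N by rewrite ltnS leq_addr.
have V2 : 2^-1 <= V.
  rewrite /V (big_cat_nat KKM (ltnW ML))/= [X in _ + X]big_ltn//=.
  rewrite ker_a// divff ?expf_neq0 ?gt_eqF// powR1.
  rewrite div1r.
  rewrite addrCA lerDl addr_ge0// sumr_ge0// => j _; exact: ker_ge0.
have V0 : 0 < V by lra.
have tot : \sum_(0 <= j < L + K + K) ker s (u0 * r ^+ j) a <= (1 + e) * V.
  have KKL := leq_trans KKM (ltnW ML).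
  rewrite -addnA (big_cat_nat (leq0n (K + K)) (leq_trans KKL (leq_addr _ _)))/=.
  rewrite (big_cat_nat KKL (leq_addr _ _))/= -/V.
  have l1 : \sum_(0 <= j < K + K) ker s (u0 * r ^+ j) a <= (K + K)%:R * e1.
    rewrite -[(K + K)%N in leRHS]subn0; apply: sum_le_const => j /andP[_ jK].
    by apply: le_trans HN1; apply: ker_low; rewrite ?(ltW s0)// leq_add2r ltnW.
  have l2 : \sum_(L <= j < L + (K + K)) ker s (u0 * r ^+ j) a <= (K + K)%:R * e1.
    rewrite -[(K + K)%N in leRHS](addKn L); apply: sum_le_const => j /andP[jL _].
    by apply: le_trans HN2; apply: ker_high; rewrite ?(ltW s1)// ltnW.
  have l3 : (K + K)%:R * e1 + (K + K)%:R * e1 <= e / 2.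
    have K0 : 0 <= K%:R :> R by [].
    rewrite /e1 natrD; move: (K%:R : R) K0 => k k0.
    rewrite -mulrDl mulrA ler_pdivrMr; last by lra.
    by nra.
  by nra.
(* The factor [r] compensates the loss in the lower comparison, so that the lower bound is exactly
   1. *)
exists L, (fun j => r / V * (u0 * r ^+ (j + K)) `^ s), (fun j => u0 * r ^+ (j + K)).
split=> [j|//|x /andP[ax xb]]; first by rewrite mulr_gt0 ?divr_gt0 ?powR_gt0.
have x0 := lt_le_trans a0 ax.
have rK1 : 1 <= r ^+ K by rewrite exprn_ege1 ?ltW.
have xa : x <= r ^+ K * a by exact: le_trans xb HK.
have ax' : a <= r ^+ K * x by rewrite (le_trans ax)// ler_peMl // ltW.
have -> : x `^ (1 - s) *
    \sum_(j < L) r / V * (u0 * r ^+ (j + K)) `^ s / (x + u0 * r ^+ (j + K)) =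
    r / V * \sum_(0 + K <= j < L + K) ker s (u0 * r ^+ j) x.
  rewrite big_addn addnK big_mkord !mulr_sumr; apply: eq_bigr => j _.
  by rewrite /ker; ring.
have s01 : 0 <= s <= 1 by rewrite !ltW.
have up := grid_comparable s r u0 s01 r1 u00 0 L K a x a0 x0 xa ax'.
have KL : (K <= L)%N by rewrite (leq_trans _ (ltnW ML))// (leq_trans (leq_addr K K)).
have := grid_comparable s r u0 s01 r1 u00 K (L - K) K x a x0 a0 ax' xa.
rewrite subnK// -/V => lo; apply/andP; split.
  by rewrite mulrAC ler_pdivlMr// mul1r.
rewrite mulrAC ler_pdivrMr//.
apply: (@le_trans _ _ (r * (r * ((1 + e) * V)))); last by rewrite /r !exprS expr0; lra.
rewrite ler_pM2l//; apply: le_trans up _; rewrite ler_pM2l//.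
Qed.

Lemma stieltjes_approx s a b (l : R) : 0 < s <= 1 -> 0 < a -> a <= b -> 1 < l ->
  exists n (c u : nat -> R),
  [/\ forall j, 0 < c j, forall j, 0 < u j &
      forall x, a <= x <= b ->
      x `^ (s - 1) <= \sum_(j < n) c j / (x + u j) <= l * x `^ (s - 1)].
Proof.
move=> /andP[s0 +] a0 ab l1; have b0 := lt_le_trans a0 ab.
rewrite le_eqVlt => /predU1P[->|s1].
  (* With this [t], [(b + t) / t = l], so [(b + t) / (x + t)] stays between 1 and [l]. *)
  pose t := b / (l - 1); have t0 : 0 < t by rewrite divr_gt0// subr_gt0.
  exists 1%N, (fun=> b + t), (fun=> t); split=> [_|//|x /andP[ax xb]].
    exact: addr_gt0.
  have x0 := lt_le_trans a0 ax.
  rewrite big_ord1 subrr powRr0 mulr1; apply/andP; split.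
    by rewrite ler_pdivlMr ?addr_gt0// mul1r lerD2r.
  rewrite ler_pdivrMr ?addr_gt0//.
  have : (l - 1) * t = b by rewrite mulrC divfK// gt_eqF ?subr_gt0.
  by nra.
(* For [e <= 1], [(1 + e) ^ 3 <= 1 + 7 e <= l]. *)
pose e := Num.min 1 ((l - 1) / 7).
have e0 : 0 < e by rewrite lt_min ltr01 divr_gt0// subr_gt0.
have e1 : e <= 1 by rewrite ge_min lexx.
have el : 1 + 7 * e <= l.
  by have : e <= (l - 1) / 7 by [rewrite ge_min lexx orbT]; lra.
have s01 : 0 < s < 1 by rewrite s0.
have [n [c [u [c0 u0 H]]]] := stieltjes_grid s a b e s01 a0 ab e0.
exists n, c, u; split => // x /[dup] /andP[ax xb] /H.
have x0 := lt_le_trans a0 ax.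
rewrite -[s - 1]opprB powRN mulrC.
have := powR_gt0 (1 - s) x0; move: (x `^ _) (\sum_(j < n) _) => P S P0 /andP[h1 h2].
have h3 : (1 + e) ^+ 3 <= l.
  apply: le_trans el; rewrite !exprS expr0; nra.
by rewrite ler_pdivlMr// (le_trans h2 h3) andbT -[P^-1]mul1r ler_pdivrMr.
Qed.

End stieltjes.

(** * Combinations of logarithms and of entropy integrands *)

Section potential.
Context {R : realType}.
Implicit Types (a b s x y : R) (n : nat) (c u : nat -> R).

Lemma ln_add_lipschitz v x y : 0 < v :> R -> 0 <= x -> 0 <= y ->
  `|ln (x + v) - ln (y + v)| <= v^-1 * `|x - y|.
Proof.
move=> v0; wlog xy : x y / y <= x.
  move=> H x0 y0; have [/H|/ltW /H] := leP y x; first exact.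
  by rewrite distrC (distrC x); apply.
move=> x0 y0; have yv : 0 < y + v by rewrite ltr_wpDl.
have xv : 0 < x + v by rewrite ltr_wpDl.
rewrite -ln_div ?posrE// !ger0_norm ?subr_ge0//; last first.
  by rewrite ln_ge0// ler_pdivlMr// mul1r lerD2r.
have -> : (x + v) / (y + v) = 1 + (x - y) / (y + v).
  by field; rewrite gt_eqF.
have h : 0 <= (x - y) / (y + v) by rewrite divr_ge0 ?subr_ge0// ltW.
apply: le_trans (le_ln1Dx _) _; first by rewrite (lt_le_trans _ h)// oppr_lt0.
by rewrite mulrC ler_wpM2r ?subr_ge0// lef_pV2 ?posrE// lerDr.
Qed.

Lemma is_derive_ln_add v x : 0 < x + v ->
  is_derive x 1 (fun t : R => ln (t + v)) (x + v)^-1.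
Proof.
move=> xv.
have h : is_derive (x + v) 1 (@ln R) (x + v)^-1 by exact: is_derive1_ln.
have := @is_derive1_comp R (@ln R) (fun t => t + v) x (x + v)^-1 1 h _.
rewrite mulr1; apply.
have : is_derive x 1 (id + cst v) (1 + 0) by exact: is_deriveD.
by rewrite addr0.
Qed.

Lemma is_derive_xlnx_add v x : 0 < x + v ->
  is_derive x 1 (fun t : R => (t + v) * ln (t + v)) (ln (x + v) + 1).
Proof.
move=> xv; have dln := is_derive_ln_add _ _ xv.
have dadd : is_derive x 1 (fun t : R => t + v) 1.
  have : is_derive x 1 (id + cst v) (1 + 0) by exact: is_deriveD.
  by rewrite addr0.
apply: (is_derive_eq (is_deriveM dadd dln)).
by rewrite scaler1 /GRing.scale/= divff ?gt_eqF// addrC.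
Qed.

Lemma is_derive_lincomb n c (h : nat -> R -> R) (dh : nat -> R) x :
  (forall j, is_derive x 1 (h j) (dh j)) ->
  is_derive x 1 (fun t => \sum_(j < n) c j * h j t) (\sum_(j < n) c j * dh j).
Proof.
move=> dhj.
have := @is_derive_sum R R R n (fun j => c j \*: h j) x 1 (fun j => c j *: dh j).
have -> : \sum_(i < n) c i \*: h i = (fun t => \sum_(j < n) c j * h j t).
  by apply/funext => t; rewrite fct_sumE.
by apply => i; exact: is_deriveZ.
Qed.

Lemma is_derive_powR_div s x : 0 < x -> s != 0 ->
  is_derive x 1 (fun t : R => t `^ s / s) (x `^ (s - 1)).
Proof.
move=> x0 s0; have d := is_derive1_powR s x0.
have := is_deriveZ (s^-1) d.
have -> : s^-1 \*: (@powR R)^~ s = (fun t : R => t `^ s / s).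
  by apply/funext => t; rewrite /= /GRing.scale/= mulrC.
by rewrite /GRing.scale/= mulrA mulVf// mul1r.
Qed.

Section approximants.
Variables (n : nat) (c u : nat -> R) (s l a b : R).
Hypotheses (s01 : 0 < s <= 1) (a0 : 0 < a) (u0 : forall j, 0 < u j).
Hypothesis cu : forall x, a <= x <= b ->
  x `^ (s - 1) <= \sum_(j < n) c j / (x + u j) <= l * x `^ (s - 1).

Let s_neq0 : s != 0. Proof. by case/andP: s01 => /gt_eqF ->. Qed.

(** [S] stands in for [x ^ s / s], its derivative being the sum in [cu]; the derivative of [G] is
    [S] plus a constant. *)
Let S x := \sum_(j < n) c j * ln (x + u j).
Let G x := \sum_(j < n) c j * ((x + u j) * ln (x + u j)).

Let dS x : a <= x -> is_derive x 1 S (\sum_(j < n) c j / (x + u j)).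
Proof.
move=> ax; apply: (is_derive_lincomb n c (fun j t => ln (t + u j)) (fun j => (x + u j)^-1)) => j.
by apply: is_derive_ln_add; rewrite addr_gt0// (lt_le_trans a0).
Qed.

(** The derivative of [S] lies between those of [x ^ s / s] and of [l * (x ^ s / s)]. The upper
    bound serves to compare forms, the lower one to prove convexity. *)
Lemma logcomb_sub_bounds x y : a <= y -> y <= x -> x <= b ->
  (x `^ s - y `^ s) / s <= S x - S y <= l * ((x `^ s - y `^ s) / s).
Proof.
move=> ay yx xb.
have dP t : y <= t <= x -> is_derive t 1 (fun t : R => t `^ s / s) (t `^ (s - 1)).
  by move=> /andP[yt _]; apply: is_derive_powR_div; rewrite // (lt_le_trans a0)// (le_trans ay).
have abt t : y <= t <= x -> a <= t <= b.
  by move=> /andP[yt tx]; rewrite (le_trans ay) ?(le_trans tx).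
apply/andP; split.
  have [|t tyx] := mean_value (S - (fun t : R => t `^ s / s))
      (fun t => \sum_(j < n) c j / (t + u j) - t `^ (s - 1)) y x yx.
    by move=> t tyx; apply: is_deriveB; [apply: dS; case/andP: (abt _ tyx)|exact: dP].
  rewrite !fctE -subr_ge0 mulrBl => E.
  have := abt _ tyx => /cu /andP[h _].
  have : 0 <= (\sum_(j < n) c j / (t + u j) - t `^ (s - 1)) * (x - y).
    by rewrite mulr_ge0 ?subr_ge0.
  by rewrite mulrBl -E; lra.
have [|t tyx] := mean_value ((l \*: (fun t : R => t `^ s / s)) - S)
    (fun t => l *: (t `^ (s - 1)) - \sum_(j < n) c j / (t + u j)) y x yx.
  move=> t tyx; apply: is_deriveB; last by apply: dS; case/andP: (abt _ tyx).
  by apply: is_deriveZ; exact: dP.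
move=> E.
have {}E : l * (x `^ s / s) - S x - (l * (y `^ s / s) - S y) =
    (l * t `^ (s - 1) - \sum_(j < n) c j / (t + u j)) * (x - y) := E.
have := abt _ tyx => /cu /andP[_ h].
have : 0 <= (l * (t `^ (s - 1)) - \sum_(j < n) c j / (t + u j)) * (x - y).
  by rewrite mulr_ge0 ?subr_ge0.
by rewrite -E; lra.
Qed.

(* [G'' = \sum c_j / (x + u_j) >= x ^ (s - 1)], so that
   [G - x ^ (1 + s) / ((1 + s) s)] is convex and lies above its tangent. *)
Lemma entcomb_tangent m : a <= m <= b ->
  exists k, forall x, a <= x <= b ->
    (x `^ (1 + s) - m `^ (1 + s)) / ((1 + s) * s) + k * (x - m) <= G x - G m.
Proof.
move=> mab; have s0 : 0 < s by case/andP: s01.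
pose P (t : R) := s^-1 * (t `^ (1 + s) / (1 + s)).
pose dH t := (\sum_(j < n) c j * (ln (t + u j) + 1)) - s^-1 * t `^ s.
exists (dH m) => x xab.
suff : (G - P) m + dH m * (x - m) <= (G - P) x.
  by rewrite !fctE /P mulrBl [((1 + s) * s)^-1]invfM !mulrA; lra.
apply: (tangent_le _ _ a b) => // [t /andP[at_ tb]|y z ay yz zb].
  have t0 := lt_le_trans a0 at_; apply: is_deriveB.
    apply: (is_derive_lincomb n c (fun j t => (t + u j) * ln (t + u j)) (fun j => ln (t + u j) + 1)).
    by move=> j; apply: is_derive_xlnx_add; rewrite addr_gt0.
  have := is_derive_powR_div (1 + s) t t0; rewrite addrAC subrr add0r.
  move=> /(_ (lt0r_neq0 (addr_gt0 ltr01 s0))); exact: is_deriveZ.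
(* [dH] is [S - x ^ s / s] up to a constant, so its monotonicity is the lower bound on the
   increments of [S]. *)
have /andP[h _] := logcomb_sub_bounds z y ay yz zb.
rewrite /dH; have ES w : \sum_(j < n) c j * (ln (w + u j) + 1) = S w + \sum_(j < n) c j.
  by rewrite -big_split/=; apply: eq_bigr => j _; rewrite mulrDr mulr1.
by rewrite !ES; move: h; rewrite mulrBl ![_ / s]mulrC; lra.
Qed.

End approximants.

End potential.

(** * Consequences of Assumption A for the domain and the form *)

Section dirichlet_form.
Context {d : measure_display} {X : measurableType d} {R : realType}.
Variables (Dom : set (X -> R)) (E : (X -> R) -> (X -> R) -> R).
Hypotheses (hE : nonneg_symmetric_form Dom E) (hA : assumptionA Dom E).
Implicit Types f g : X -> R.

Lemma dom0 : Dom 0.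
Proof. by have [h _] := dom_subspace hE; move: h; rewrite unfold_in/= inE. Qed.

Lemma dom_lin k f g : Dom f -> Dom g -> Dom (k *: f + g).
Proof.
move=> Df Dg; have [_ h] := dom_subspace hE.
by have := h k f g; rewrite !unfold_in/= !inE; apply.
Qed.

(** Precomposing [phi] with the maximum with [a] and dividing by [k] gives a contraction of the
    whole line; linearity restores the factor [k]. *)
Lemma dom_lipschitz (phi : R -> R) (k a : R) f : 0 < k ->
  (forall x y, a <= x -> a <= y -> `|phi x - phi y| <= k * `|x - y|) ->
  Dom f -> (forall x, a <= f x) -> Dom (phi \o f).
Proof.
move=> k0 phik Df af; have [hc _] := hA.
have h : 1.-lipschitz (fun t : R => k^-1 * phi (Num.max t a)).
  move=> [x y] _.
  change (`|k^-1 * phi (Num.max x a) - k^-1 * phi (Num.max y a)| <= 1 * `|x - y|).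
  rewrite -mulrBr normrM ger0_norm ?invr_ge0 ?(ltW k0)// ler_pdivrMl//.
  rewrite mul1r; apply: (le_trans (phik _ _ _ _)); rewrite ?le_max ?lexx ?orbT//.
  rewrite ler_pM2l//.
  wlog xy : x y / y <= x.
    move=> H; have [/H//|/ltW /H] := leP y x.
    by rewrite distrC (distrC y).
  rewrite ger0_norm ?subr_ge0//; last first.
    by rewrite ge_max le_max xy/= le_max lexx orbT.
  rewrite ger0_norm ?subr_ge0//.
  by case: (leP x a) => xa; case: (leP y a) => ya; lra.
have := dom_lin k _ _ (hc _ h _ Df) dom0.
congr Dom; apply/funext => x /=.
rewrite /GRing.add/= /GRing.scale/= addr0 max_l//.
by rewrite /GRing.scale/= mulVKf// gt_eqF.
Qed.

Lemma dom_contr (phi : R -> R) f : (forall x y, `|phi x - phi y| <= `|x - y|) ->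
  Dom f -> Dom (phi \o f).
Proof.
move=> h; have [hc _] := hA; apply: hc => -[x y] _.
by change (`|phi x - phi y| <= 1 * `|x - y|); rewrite mul1r.
Qed.

(** A constant map is a contraction, and 0 is in the domain. *)
Lemma dom_cst c : Dom (cst c).
Proof.
by apply: (dom_contr (cst c) 0 _ dom0) => x y; rewrite subrr normr0.
Qed.

Lemma dom_add_cst f c : Dom f -> Dom (fun x => f x + c).
Proof.
move=> Df; have := dom_lin 1 _ _ Df (dom_cst c).
by congr Dom; apply/funext => x; rewrite scale1r.
Qed.

Lemma dom_ln_add f v : Dom f -> (forall x, 0 <= f x) -> 0 < v ->
  Dom (fun x => ln (f x + v)).
Proof.
move=> Df f0 v0; apply: (dom_lipschitz (fun t => ln (t + v)) v^-1 0) => //.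
  by rewrite invr_gt0.
by move=> x y; exact: ln_add_lipschitz.
Qed.

Lemma form_le f1 f2 g1 g2 : Dom f1 -> Dom f2 -> Dom g1 -> Dom g2 ->
  (forall x y, (f1 x - f1 y) * (f2 x - f2 y) <= (g1 x - g1 y) * (g2 x - g2 y)) ->
  E f1 f2 <= E g1 g2.
Proof. by have [_] := hA; apply. Qed.

Lemma form_lincomb n (c : nat -> R) (h : nat -> X -> R) f :
  Dom f -> (forall j, Dom (h j)) ->
  Dom (fun x => \sum_(j < n) c j * h j x) /\
  E f (fun x => \sum_(j < n) c j * h j x) = \sum_(j < n) c j * E f (h j).
Proof.
move=> Df Dh; elim: n => [|n [IH1 IH2]].
  have -> : (fun x => \sum_(j < 0) c j * h j x) = 0.
    by apply/funext => x; rewrite big_ord0.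
  split; first exact: dom0.
  rewrite big_ord0; have := form_linearr hE 1 dom0 dom0 Df.
  by rewrite scale1r addr0 mul1r => /eqP; rewrite -subr_eq subrr eq_sym => /eqP.
have -> : (fun x => \sum_(j < n.+1) c j * h j x) =
    c n *: h n + (fun x => \sum_(j < n) c j * h j x).
  by apply/funext => x; rewrite big_ord_recr addrC.
split; first exact: dom_lin.
by rewrite (form_linearr hE)// IH2 big_ord_recr/= addrC.
Qed.

Lemma form_scaler k f h : Dom f -> Dom h ->
  Dom (fun x => k * h x) /\ E f (fun x => k * h x) = k * E f h.
Proof.
move=> Df Dh; have := form_lincomb 1 (fun=> k) (fun=> h) f Df (fun=> Dh).
by rewrite big_ord1; under eq_fun do rewrite big_ord1.
Qed.

End dirichlet_form.

(** * Integrals of bounded functions under a probability *)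

Section bounded_integrals.
Context {d : measure_display} {X : measurableType d} {R : realType}.
Variable mu : probability X R.

Lemma integrable_bounded_fun (g : X -> R) (M : R) : measurable_fun setT g ->
  (forall x, `|g x| <= M) -> mu.-integrable setT (EFin \o g).
Proof.
move=> mg gM; apply: measurable_bounded_integrable => //.
  exact: le_lt_trans (probability_le1 mu measurableT) (ltry 1).
exists M; split; first exact: num_real.
by move=> N MN x _ /=; apply: le_trans (gM x) (ltW MN).
Qed.

Lemma expectation_Rintegral (g : X -> R) : mu.-integrable setT (EFin \o g) ->
  'E_mu[g]%E = (\int[mu]_x g x)%:E.
Proof.
by move=> ig; rewrite unlock /Rintegral fineK//; exact: integrable_fin_num.
Qed.

Lemma Rintegral_cst_prob (r : R) : \int[mu]_x (fun=> r) x = r.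
Proof. by rewrite Rintegral_cst//= probability_setT mulr1. Qed.

Lemma integrable_cst_prob (r : R) : mu.-integrable setT (EFin \o (fun _ : X => r)).
Proof. exact: (integrable_bounded_fun _ `|r|). Qed.

Lemma Rintegral_lincomb n (c : nat -> R) (h : nat -> X -> R) :
  (forall j, mu.-integrable setT (EFin \o h j)) ->
  mu.-integrable setT (EFin \o (fun x => \sum_(j < n) c j * h j x)) /\
  \int[mu]_x (\sum_(j < n) c j * h j x) = \sum_(j < n) c j * \int[mu]_x h j x.
Proof.
move=> ih; elim: n => [|n [IH1 IH2]].
  have -> : (fun x => \sum_(j < 0) c j * h j x) = fun=> 0.
    by apply/funext => x; rewrite big_ord0.
  by split; [exact: integrable_cst_prob|rewrite Rintegral_cst_prob big_ord0].
have i1 : mu.-integrable setT (EFin \o (fun x => c n * h n x)).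
  exact: (integrableZl _ (c n) (ih n)).
have -> : (fun x => \sum_(j < n.+1) c j * h j x) =
    (fun x => (\sum_(j < n) c j * h j x) + c n * h n x).
  by apply/funext => x; rewrite big_ord_recr.
split; first exact: (integrableD _ IH1 i1).
by rewrite RintegralD// IH2 RintegralZl// big_ord_recr.
Qed.

End bounded_integrals.

(** * Beckner's inequality for functions bounded above and away from 0 *)

Section beckner.
Context {d : measure_display} {X : measurableType d} {R : realType}.
Variables (mu : probability X R) (Dom : set (X -> R)).
Variables (E : (X -> R) -> (X -> R) -> R) (rho0 : R).
Hypotheses (hE : nonneg_symmetric_form Dom E) (hA : assumptionA Dom E).
Hypotheses (rho0_gt0 : 0 < rho0) (hmlsi : mlsi mu Dom E rho0).

Lemma abs_xlnx_le (t : R) : 0 < t -> `|t * ln t| <= t ^+ 2 + 1.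
Proof.
move=> t0; rewrite normrM gtr0_norm//.
have h1 : ln t < t := ln_sublinear t0.
have h2 : - ln t < t^-1 by rewrite -lnV ?posrE// ln_sublinear// invr_gt0.
have -> : t ^+ 2 + 1 = t * (t + t^-1) by rewrite mulrDr divff ?gt_eqF// expr2.
have ti0 : 0 < t^-1 by rewrite invr_gt0.
by rewrite ler_pM2l// ler_norml; apply/andP; split; lra.
Qed.

Section bounded.
Variables (f : X -> R) (a b : R).
Hypotheses (Df : Dom f) (a0 : 0 < a) (fab : forall x, a <= f x <= b).

Let mf : measurable_fun setT f. Proof. exact: dom_measurable hE _ Df. Qed.
Let f_gt0 x : 0 < f x.
Proof. by case/andP: (fab x) => + _; exact: lt_le_trans. Qed.
Let f_le x : f x <= b. Proof. by case/andP: (fab x). Qed.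

Let m := \int[mu]_x f x.

Let int_f : mu.-integrable setT (EFin \o f).
Proof. by apply: (integrable_bounded_fun mu f b mf) => x; rewrite gtr0_norm. Qed.

Let m_itv : a <= m <= b.
Proof.
rewrite -[a](Rintegral_cst_prob mu) -[b](Rintegral_cst_prob mu).
by apply/andP; split; apply: le_Rintegral => //; try exact: integrable_cst_prob;
  move=> x _; case/andP: (fab x).
Qed.

Let m_gt0 : 0 < m. Proof. by case/andP: m_itv => + _; exact: lt_le_trans. Qed.

Let mf_add (v : R) : measurable_fun setT (fun x => f x + v).
Proof. exact: measurable_funD. Qed.

Let int_xlnx (v : R) : 0 < v ->
  mu.-integrable setT (EFin \o (fun x => (f x + v) * ln (f x + v))).
Proof.
move=> v0; apply: (integrable_bounded_fun mu _ ((b + v) ^+ 2 + 1)).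
  apply: measurable_funM => //.
  exact: (measurableT_comp (@measurable_ln R) (mf_add v)).
move=> x; have fv0 : 0 < f x + v by rewrite addr_gt0.
apply: le_trans (abs_xlnx_le _ fv0) _; rewrite lerD2r.
by rewrite lerXn2r ?nnegrE ?(ltW fv0) ?lerD2r// (le_trans (ltW fv0))// lerD2r.
Qed.

Let int_powR (p : R) : 0 <= p -> mu.-integrable setT (EFin \o (fun x => f x `^ p)).
Proof.
move=> p0; apply: (integrable_bounded_fun mu _ (b `^ p)).
  exact: (measurableT_comp (@measurable_powR R p) mf).
move=> x; rewrite ger0_norm ?powR_ge0// ge0_ler_powR// nnegrE ?(ltW (f_gt0 x))//.
by rewrite (le_trans _ (f_le x))// ltW.
Qed.

(** The functions [f] and [f + v] have the same increments, so the comparison property bounds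
    [E (f + v, ln (f + v))] by [E (f, ln (f + v))]. *)
Lemma mlsi_add (v : R) : 0 < v ->
  rho0 * (\int[mu]_x ((f x + v) * ln (f x + v)) - (m + v) * ln (m + v)) <=
  E f (fun x => ln (f x + v)).
Proof.
move=> v0; have Dfv := dom_add_cst _ _ hE hA f v Df.
have Dln : Dom (fun x => ln (f x + v)).
  by apply: (dom_ln_add _ _ hE hA f v) => // x; rewrite ltW.
have fv0 x : 0 < f x + v by rewrite addr_gt0.
have [_] := hmlsi _ Dfv fv0 Dln.
rewrite /Ent (expectation_Rintegral mu _ (int_xlnx v v0)).
have iv : mu.-integrable setT (EFin \o (fun x => f x + v)).
  exact: (integrableD _ int_f (integrable_cst_prob mu v)).
rewrite (expectation_Rintegral mu _ iv) RintegralD//; last exact: integrable_cst_prob.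
rewrite Rintegral_cst_prob -/m lne_EFin ?addr_gt0// lee_fin => /le_trans; apply.
apply: (form_le _ _ hA) => // x y.
by rewrite [X in X * _ <= _](_ : _ = f x - f y)//; ring.
Qed.

Lemma beckner_bounded (s : R) : 0 < s <= 1 -> Dom (fun x => f x `^ s) ->
  rho0 * (\int[mu]_x (f x `^ (1 + s)) - m `^ (1 + s)) <=
  (1 + s) * E f (fun x => f x `^ s).
Proof.
move=> s01 Dfs; have s0 : 0 < s by case/andP: s01.
have ab : a <= b by case/andP: m_itv; exact: le_trans.
suff H (l : R) : 1 < l -> rho0 * (\int[mu]_x (f x `^ (1 + s)) - m `^ (1 + s)) <=
    l * ((1 + s) * E f (fun x => f x `^ s)).
  move: H; move: (rho0 * _) ((1 + s) * _) => A B H.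
  rewrite leNgt; apply/negP => BA.
  (* For this [l], [l * B <= B + (A - B) / 2 < A], a contradiction. *)
  have := H (1 + (A - B) / (2 * (`|B| + 1))).
  have B0 : 0 <= `|B| by []; have BB := ler_norm B.
  have t0 : 0 < (A - B) / (2 * (`|B| + 1)) by rewrite divr_gt0; lra.
  have tE : (A - B) / (2 * (`|B| + 1)) * (2 * (`|B| + 1)) = A - B.
    by rewrite divfK// gt_eqF//; lra.
  move=> /(_ ltac:(lra)); nra.
move=> l1; have [n [c [u [c0 u0 cu]]]] := stieltjes_approx s a b l s01 a0 ab l1.
pose S x := \sum_(j < n) c j * ln (x + u j).
pose G x := \sum_(j < n) c j * ((x + u j) * ln (x + u j)).
have Dln j : Dom (fun x => ln (f x + u j)).
  by apply: (dom_ln_add _ _ hE hA f (u j)) => // x; rewrite ltW.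
have [DS ES] := form_lincomb _ _ hE n c (fun j x => ln (f x + u j)) f Df Dln.
have [DP EP] := form_scaler _ _ hE (l / s) _ _ Df Dfs.
(* The increments of [S] along [f] have the sign of those of [f] and are at most [l / s] times those
   of [f ^ s], so the comparison property applies. *)
have up : E f (S \o f) <= l / s * E f (fun x => f x `^ s).
  rewrite -EP; apply: (form_le _ _ hA) => // x y.
  wlog yx : x y / f y <= f x.
    move=> H; have [/H//|/ltW /H] := leP (f y) (f x).
    by rewrite -[f y - f x]opprB -[S (f y) - _]opprB -[_ - l / s * _]opprB !mulrNN.
  rewrite ler_wpM2l ?subr_ge0//.
  have /andP[ay _] := fab y; have /andP[_ xb] := fab x.
  have /andP[_ h] := logcomb_sub_bounds n c u s l a b s01 a0 u0 cu (f x) (f y) ay yx xb.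
  by apply: le_trans h _; rewrite -mulrBr mulrA mulrAC.
have [iG EG] := Rintegral_lincomb mu n c _ (fun j => int_xlnx (u j) (u0 j)).
have low : rho0 * (\int[mu]_x G (f x) - G m) <= E f (S \o f).
  rewrite ES EG /G -sumrB mulr_sumr ler_sum// => j _.
  by rewrite -mulrBr mulrCA ler_pM2l ?mlsi_add.
have [k tang] := entcomb_tangent n c u s l a b s01 a0 u0 cu m m_itv.
have s10 : 0 < 1 + s by rewrite addr_gt0.
pose q := ((1 + s) * s)^-1; have q0 : 0 < q by rewrite invr_gt0 mulr_gt0.
(* The tangent inequality at the mean [m] is integrated; its linear term [k * (f - m)] has integral
   0. *)
have jensen : q * (\int[mu]_x (f x `^ (1 + s)) - m `^ (1 + s)) <= \int[mu]_x G (f x) - G m.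
  pose C := G m - q * m `^ (1 + s) - k * m.
  have ip := int_powR (1 + s) (ltW s10).
  have ip' : mu.-integrable setT (EFin \o (fun x => q * f x `^ (1 + s))).
    exact: (integrableZl _ q ip).
  have ik : mu.-integrable setT (EFin \o (fun x => k * f x)).
    exact: (integrableZl _ k int_f).
  have ikC : mu.-integrable setT (EFin \o (fun x => k * f x + C)).
    exact: (integrableD _ ik (integrable_cst_prob mu C)).
  have : \int[mu]_x (q * f x `^ (1 + s) + (k * f x + C)) <= \int[mu]_x G (f x).
    apply: le_Rintegral => //; first exact: (integrableD _ ip' ikC).
    move=> x _; have := tang _ (fab x); rewrite -/(G (f x)) -/(G m) [_ / _]mulrC -/q /C.
    by lra.
  rewrite RintegralD// RintegralZl// RintegralD//; last exact: integrable_cst_prob.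
  by rewrite RintegralZl// Rintegral_cst_prob -/m /C; lra.
set D := _ - m `^ _ in jensen *; set F := E f (fun x => f x `^ s) in up *.
have : rho0 * (q * D) <= l / s * F.
  apply: le_trans up; apply: le_trans low; by rewrite ler_pM2l.
have s1s : (1 + s) * s * q = 1 by rewrite divff// mulf_neq0// gt_eqF.
have -> : rho0 * D = (1 + s) * s * (rho0 * (q * D)).
  by transitivity (rho0 * D * ((1 + s) * s * q)); [rewrite s1s mulr1|ring].
have -> : l * ((1 + s) * F) = (1 + s) * s * (l / s * F).
  by field; rewrite gt_eqF.
by move=> h; rewrite ler_pM2l ?mulr_gt0.
Qed.

End bounded.
End beckner.

(** * Truncation to a compact interval *)

Section truncation.
Context {R : realType}.
Implicit Types (e N x y : R).

Definition clip e N x := Num.max (Num.min x N) e.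

Lemma clip_itv e N x : e <= N -> e <= clip e N x <= N.
Proof. by move=> eN; rewrite /clip le_max lexx orbT ge_max ge_min lexx orbT. Qed.

Lemma clip_sub e N x y : y <= x -> 0 <= clip e N x - clip e N y <= x - y.
Proof.
move=> yx; rewrite /clip.
by case: (leP x N) => ?; case: (leP y N) => ?;
  case: (leP x e) => ?; case: (leP y e) => ?; case: (leP N e) => ?;
  apply/andP; split; lra.
Qed.

Lemma clip_contr e N x y : `|clip e N x - clip e N y| <= `|x - y|.
Proof.
wlog yx : x y / y <= x.
  move=> H; have [/H//|/ltW /H] := leP y x.
  by rewrite distrC (distrC y).
by have /andP[h1 h2] := clip_sub e N x y yx; rewrite !ger0_norm ?subr_ge0// -subr_ge0.
Qed.

(** Powers are monotone, hence commute with clipping. Thus the power of a clipped function is a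
    contraction of [f ^ s] and stays in the domain. *)
Lemma powR_clip e N x s : 0 < e -> e <= N -> 0 <= x -> 0 <= s ->
  clip e N x `^ s = clip (e `^ s) (N `^ s) (x `^ s).
Proof.
move=> e0 eN x0 s0; have N0 : 0 <= N by rewrite (le_trans _ eN)// ltW.
have mono y z : 0 <= y -> 0 <= z -> y <= z -> y `^ s <= z `^ s.
  by move=> y0 z0; apply: ge0_ler_powR; rewrite ?nnegrE.
rewrite /clip; have [xN|/ltW Nx] := leP x N.
  rewrite (min_l (mono _ _ x0 N0 xN)).
  have [xe|/ltW ex] := leP x e; first by rewrite max_r// mono// ltW.
  by rewrite max_l// mono// ltW.
rewrite (min_r (mono _ _ N0 x0 Nx)) !max_l//.
by rewrite mono// ltW.
Qed.

(** Right continuity of the power at [m]: if the conclusion failed, [m] would be less than the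
    [p]-th root [t] of [A - C], and so would [m + e] for [e] at most half the gap. *)
Lemma le_powR_add_limit (A C m p e0 : R) : 0 < p -> 0 <= m -> 0 < e0 ->
  (forall e, 0 < e -> e <= e0 -> A <= C + (m + e) `^ p) -> A <= C + m `^ p.
Proof.
move=> p0 m0 e00 H; rewrite leNgt; apply/negP => AC.
have mAC : m `^ p < A - C by lra.
have AC0 : 0 < A - C by apply: le_lt_trans mAC; exact: powR_ge0.
pose t := (A - C) `^ p^-1.
have tp : t `^ p = A - C by rewrite -powRrM mulVf ?gt_eqF// powRr1// ltW.
have t0 : 0 <= t by exact: powR_ge0.
have mt : m < t.
  rewrite ltNge; apply/negP => tm.
  have : t `^ p <= m `^ p by rewrite ge0_ler_powR ?nnegrE// ltW.
  by rewrite tp leNgt mAC.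
pose e := Num.min e0 ((t - m) / 2).
have e_gt0 : 0 < e by rewrite lt_min e00 divr_gt0// subr_gt0.
have ee : e <= e0 by rewrite ge_min lexx.
have et : e <= (t - m) / 2 by rewrite ge_min lexx orbT.
have := H _ e_gt0 ee.
have : (m + e) `^ p < t `^ p by rewrite gt0_ltr_powR ?nnegrE//; lra.
by rewrite tp; lra.
Qed.

End truncation.

(** * Removal of the bounds on [f] *)

Section beckner_unbounded.
Context {d : measure_display} {X : measurableType d} {R : realType}.
Variables (mu : probability X R) (Dom : set (X -> R)).
Variables (E : (X -> R) -> (X -> R) -> R) (rho0 : R).
Hypotheses (hE : nonneg_symmetric_form Dom E) (hA : assumptionA Dom E).
Hypotheses (rho0_gt0 : 0 < rho0) (hmlsi : mlsi mu Dom E rho0).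

(** Integrability comes from the entropy of [f + 1] being well defined: since [t <= t ln t + 1], an
    infinite mean would make both of its terms infinite. *)
Lemma mlsi_integrable (f : X -> R) : Dom f -> (forall x, 0 <= f x) ->
  mu.-integrable setT (EFin \o f).
Proof.
move=> Df f0; have mf := dom_measurable hE Df.
pose f1 x := f x + 1; pose h x := f1 x * ln (f1 x).
have f1_gt0 x : 0 < f1 x by rewrite ltr_wpDl.
have mf1 : measurable_fun setT f1 by exact: measurable_funD.
have h0 x : 0 <= h x by rewrite mulr_ge0 ?ln_ge0 ?(ltW (f1_gt0 x))// lerDr.
have mh : measurable_fun setT h.
  apply: measurable_funM => //.
  exact: (measurableT_comp (@measurable_ln R) mf1).
have Dln : Dom (fun x => ln (f1 x)) by exact: (dom_ln_add _ _ hE hA).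
have [+ _] := hmlsi _ (dom_add_cst _ _ hE hA f 1 Df) f1_gt0 Dln.
rewrite /Ent_def -/f1 -/h => hdef.
have BA : ('E_mu[f1] <= 'E_mu[h] + 1)%E.
  rewrite -[1%E](expectation_cst mu 1) unlock -ge0_integralD//=; last 2 first.
    by move=> x _; rewrite lee_fin.
    exact/measurable_EFinP.
  apply: ge0_le_integral => //=.
  - by move=> x _; rewrite lee_fin ltW.
  - exact/measurable_EFinP.
  - by apply/measurable_EFinP; exact: measurable_funD.
  - move=> x _; rewrite -EFinD lee_fin /h; move: (f1 x) (f1_gt0 x) => t t0.
    have ti : 0 < t^-1 by rewrite invr_gt0.
    have h1 : - ln t <= t^-1 - 1.
      rewrite -lnV ?posrE// -[X in ln X](subrKC 1).
      by apply: le_ln1Dx; lra.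
    have h2 : t * t^-1 = 1 by rewrite divff ?gt_eqF.
    by nra.
have Boo : ('E_mu[f1] < +oo)%E.
  rewrite ltey; apply/eqP => B; move: hdef BA; rewrite B [lne _]/= mulyy.
  by case: ('E_mu[h])%E.
apply/integrableP; split; first exact/measurable_EFinP.
apply: le_lt_trans Boo; rewrite unlock; apply: ge0_le_integral => //=.
- by apply/measurable_EFinP; exact: measurableT_comp.
- exact/measurable_EFinP.
- by move=> x _; rewrite lee_fin ger0_norm// lerDl.
Qed.

(** The bounded case is applied to [f] clipped to [[e, N]], whose mean exceeds that of [f] by at
    most [e]; then [e] tends to 0. The bound obtained does not depend on [N]. *)
Lemma beckner_truncated (f : X -> R) (s N : R) : 0 < s <= 1 -> Dom f ->
  (forall x, 0 <= f x) -> Dom (fun x => f x `^ s) -> 0 < N ->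
  \int[mu]_x (Num.min (f x) N `^ (1 + s)) <=
  (1 + s) / rho0 * E f (fun x => f x `^ s) + (\int[mu]_x f x) `^ (1 + s).
Proof.
move=> s01 Df f0 Dfs N0; have s0 : 0 < s by case/andP: s01.
have mf := dom_measurable hE Df; have intf := mlsi_integrable f Df f0.
have s10 : 0 < 1 + s by rewrite addr_gt0.
apply: (le_powR_add_limit _ _ _ _ N) => //; first exact: Rintegral_ge0.
move=> e e0 eN; pose g x := clip e N (f x).
have gab x : e <= g x <= N by exact: clip_itv.
have Dg : Dom g by apply: (dom_contr _ _ hA (clip e N) f) => //; exact: clip_contr.
have gs x : g x `^ s = clip (e `^ s) (N `^ s) (f x `^ s) by rewrite /g powR_clip// ltW.
have Dgs : Dom (fun x => g x `^ s).
  under eq_fun do rewrite gs.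
  apply: (dom_contr _ _ hA (clip (e `^ s) (N `^ s)) (fun x => f x `^ s)) => //.
  exact: clip_contr.
(* Clipping reduces the increments of [f] and of [f ^ s] without reversing their signs. *)
have Egf : E g (fun x => g x `^ s) <= E f (fun x => f x `^ s).
  apply: (form_le _ _ hA) => // x y; rewrite !gs.
  wlog yx : x y / f y <= f x.
    move=> H; have [/H//|/ltW /H] := leP (f y) (f x).
    by rewrite -[f y - f x]opprB -[f y `^ s - _]opprB -[g y - _]opprB
      -[clip _ _ (f y `^ s) - _]opprB !mulrNN.
  have yxs : f y `^ s <= f x `^ s by rewrite ge0_ler_powR ?nnegrE// ltW.
  have /andP[h1 h2] := clip_sub e N _ _ yx.
  have /andP[h3 h4] := clip_sub (e `^ s) (N `^ s) _ _ yxs.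
  exact: ler_pM.
have mg : measurable_fun setT g by exact: (dom_measurable hE Dg).
have g0 x : 0 < g x by case/andP: (gab x) => + _; exact: lt_le_trans.
have intg : mu.-integrable setT (EFin \o g).
  by apply: (integrable_bounded_fun mu _ N mg) => x; rewrite gtr0_norm//; case/andP: (gab x).
have intp (k : X -> R) : measurable_fun setT k -> (forall x, 0 <= k x <= N) ->
    mu.-integrable setT (EFin \o (fun x => k x `^ (1 + s))).
  move=> mk kN; apply: (integrable_bounded_fun mu _ (N `^ (1 + s))).
    exact: (measurableT_comp (@measurable_powR R (1 + s)) mk).
  move=> x; have /andP[k0 kx] := kN x.
  by rewrite ger0_norm ?powR_ge0// ge0_ler_powR ?nnegrE// ltW.
have main := beckner_bounded mu Dom E rho0 hE hA rho0_gt0 hmlsi g e N Dg e0 gab s s01 Dgs.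
have gm : \int[mu]_x g x <= \int[mu]_x f x + e.
  rewrite -[e in leRHS](Rintegral_cst_prob mu) -RintegralD//; last exact: integrable_cst_prob.
  apply: le_Rintegral => //; first exact: (integrableD _ intf (integrable_cst_prob mu e)).
  move=> x _; rewrite /g /clip ge_max lerDr f0 andbT ge_min.
  by rewrite lerDl (ltW e0).
have gm' : (\int[mu]_x g x) `^ (1 + s) <= (\int[mu]_x f x + e) `^ (1 + s).
  rewrite ge0_ler_powR ?nnegrE ?(ltW s10)//; first by apply: Rintegral_ge0 => x _; rewrite ltW.
  by rewrite addr_ge0 ?(ltW e0)//; apply: Rintegral_ge0.
have le1 : \int[mu]_x (Num.min (f x) N `^ (1 + s)) <= \int[mu]_x (g x `^ (1 + s)).
  apply: le_Rintegral => //.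
  - apply: intp; first exact: measurable_minr.
    by move=> x; rewrite le_min f0 (ltW N0) ge_min lexx orbT.
  - by apply: intp => // x; rewrite (ltW (g0 x)); case/andP: (gab x).
  - move=> x _; rewrite ge0_ler_powR ?(ltW s10) ?nnegrE ?(ltW (g0 x)) ?le_min ?f0 ?(ltW N0)//.
    by rewrite /g /clip le_max lexx.
apply: le_trans le1 _.
apply: (@le_trans _ _ ((1 + s) / rho0 * E f (fun x => f x `^ s) +
    (\int[mu]_x g x) `^ (1 + s))); last by rewrite lerD2l.
rewrite -lerBlDr -(ler_pM2l rho0_gt0); apply: le_trans main _.
rewrite mulrA mulrCA divff ?gt_eqF// mulr1 ler_pM2l//.
Qed.

(** Monotone convergence in the truncation level bounds the mean of [f ^ p] by the finite [B], which
    also makes the deficit well defined. *)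
Lemma beckner_half (p : R) : 1 < p <= 2 -> beckner mu Dom E p (rho0 / 2).
Proof.
move=> /andP[p1 p2] f Df f0 Dfs.
have s01 : 0 < p - 1 <= 1 by apply/andP; split; lra.
have mf := dom_measurable hE Df; have intf := mlsi_integrable f Df f0.
have p0 : 0 < p by lra.
set m := \int[mu]_x f x; pose B := p / rho0 * E f (fun x => f x `^ (p - 1)) + m `^ p.
(* The level is [n + 1] because truncation requires a positive level. *)
have trunc n : \int[mu]_x (Num.min (f x) n.+1%:R `^ p) <= B.
  have := beckner_truncated f (p - 1) n.+1%:R s01 Df f0 Dfs (ltr0Sn _ _).
  by rewrite subrKC.
pose k n x := (Num.min (f x) n.+1%:R `^ p)%:E.
have kn0 n x : 0 <= Num.min (f x) n.+1%:R by rewrite le_min f0 ler0n.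
have mk n : measurable_fun setT (k n).
  apply/measurable_EFinP; apply: (measurableT_comp (@measurable_powR R p)).
  exact: measurable_minr.
have ndk x : setT x -> {homo k ^~ x : n n' / (n <= n')%N >-> (n <= n')%E}.
  move=> _ n n' nn'; rewrite lee_fin ge0_ler_powR ?nnegrE// ?(ltW p0)//.
  by rewrite le_min ge_min lexx/= ge_min ler_nat ltnS nn' orbT.
have limk x : limn (k ^~ x) = (f x `^ p)%:E.
  apply: cvg_lim => //; apply: cvg_near_cst.
  near=> n; rewrite /k min_l//.
  near: n; exists (Num.bound (f x)) => // n /= Hn.
  have := archi_boundP (f0 x) => /ltW /le_trans; apply.
  by rewrite ler_nat leqW.
have leB : ('E_mu[fun x => (f x `^ p)%R] <= B%:E)%E.
  rewrite unlock; under eq_integral do rewrite -limk.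
  rewrite monotone_convergence//; last by move=> n x _; rewrite lee_fin powR_ge0.
  apply: lime_le.
    apply: ereal_nondecreasing_is_cvgn => n n' nn'; apply: ge0_le_integral => //.
    - by move=> x _; rewrite lee_fin powR_ge0.
    - by move=> x _; exact: ndk.
  apply: nearW => n.
  have ik : mu.-integrable setT (EFin \o (fun x => Num.min (f x) n.+1%:R `^ p)).
    apply: (integrable_bounded_fun mu _ (n.+1%:R `^ p)); first exact/measurable_EFinP/mk.
    move=> x; rewrite ger0_norm ?powR_ge0// ge0_ler_powR ?nnegrE ?(ltW p0)//.
    by rewrite ge_min lexx orbT.
  by have := trunc n; rewrite -lee_fin -(expectation_Rintegral mu _ ik) unlock.
have E0 : (0 <= 'E_mu[fun x => (f x `^ p)%R])%E.
  by apply: expectation_ge0 => x; exact: powR_ge0.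
rewrite /beckner_deficit_def /beckner_deficit (expectation_Rintegral mu f intf) -/m.
move: leB E0; case: ('E_mu[fun x => (f x `^ p)%R])%E => [A||]//=.
rewrite !lee_fin => AB _; split => //.
have Bm : B - m `^ p = p / rho0 * E f (fun x => f x `^ (p - 1)) by rewrite /B addrK.
have -> : p / 2 * E f (fun x => f x `^ (p - 1)) = rho0 / 2 * (B - m `^ p).
  by rewrite Bm; field; rewrite gt_eqF.
by rewrite ler_pM2l ?divr_gt0// lerD2r.
Unshelve. all: by end_near. Qed.

End beckner_unbounded.

(** * Estimates of [kfun] and [Kbeckner] *)

Section constants.
Context {R : realType}.
Implicit Types (p q s t theta x y : R).

Lemma ln_ge_onesub_inv x : 0 < x -> 1 - x^-1 <= ln x.
Proof.
move=> x0; have xi : 0 < x^-1 by rewrite invr_gt0.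
have : ln x^-1 <= x^-1 - 1 by rewrite -[X in ln X](subrKC 1); apply: le_ln1Dx; lra.
by rewrite lnV ?posrE//; lra.
Qed.

(** Bernoulli's inequality. With [1 + x = e ^ y], the bound [e ^ z >= 1 + z] gives [s e ^ (y - s y)
    + (1 - s) e ^ (- s y) >= 1], the linear terms cancelling; it remains to multiply by
    [e ^ (s y)]. *)
Lemma powR_add1_le s x : 0 <= s <= 1 -> 0 < 1 + x -> (1 + x) `^ s <= 1 + s * x.
Proof.
move=> /andP[s0 s1] x0; rewrite /powR gt_eqF//.
have [y ->] : exists y, x = expR y - 1.
  by exists (ln (1 + x)); rewrite lnK ?posrE// addrAC subrr add0r.
rewrite subrKC expRK.
have h1 := expR_ge1Dx (y - s * y); have h2 := expR_ge1Dx (- (s * y)).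
have E0 := expR_gt0 (s * y).
have E1 : expR y = expR (s * y) * expR (y - s * y) by rewrite -expRD subrKC.
have E2 : expR (s * y) * expR (- (s * y)) = 1 by rewrite expRxMexpNx_1.
move: E1 E2 h1 h2 E0.
move: (expR (s * y)) (expR y) (expR (y - _)) (expR (- _)) => A B C D -> AD h1 h2 A0.
have h : 1 <= s * C + (1 - s) * D.
  have k1 : 0 <= s * (C - (1 + (y - s * y))) by rewrite mulr_ge0// subr_ge0.
  have k2 : 0 <= (1 - s) * (D - (1 + (- (s * y)))) by rewrite mulr_ge0// subr_ge0.
  by lra.
have : A * 1 <= A * (s * C + (1 - s) * D) by rewrite ler_pM2l.
by rewrite mulr1 mulrDr [A * ((1 - s) * D)]mulrCA AD; lra.
Qed.

Let weight p theta := theta `^ (p - 1) / (expR (p - 1) * (1 + theta) `^ (p - 1)).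

Let weightE p theta : 0 < theta ->
  weight p theta = expR ((p - 1) * (ln theta - 1 - ln (1 + theta))).
Proof.
move=> t0; rewrite /weight /powR !gt_eqF ?addr_gt0// -expRD -expRB.
by congr expR; ring.
Qed.

(** The first factor is at most 1 and [theta / (1 + theta) < 1], which leaves
    [e ^ (- (p - 1)) <= 1 / p]. *)
Lemma kfun_le p theta : 1 < p -> 0 < theta < 1 -> kfun p theta <= p^-1.
Proof.
move=> p1 /andP[t0 t1]; rewrite /kfun -/(weight p theta) weightE//.
have p0 : 0 < p by lra.
set B := expR _; set Q := _ / _.
have Q0 : 0 <= Q.
  rewrite divr_ge0// ?mulr_ge0 ?sqr_ge0 ?subr_ge0 ?(ltW p1) ?(ltW p0) ?(ltW t1)//.
  have : 1 `^ p <= (1 + theta) `^ p by rewrite ge0_ler_powR ?nnegrE ?(ltW p0)//; lra.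
  by rewrite powR1.
have B0 : 0 < B by exact: expR_gt0.
apply: (@le_trans _ _ B); first by nra.
have ln_le : ln theta <= ln (1 + theta) by rewrite ler_ln ?posrE; lra.
apply: (@le_trans _ _ (expR (- (p - 1)))).
  by rewrite ler_expR -[leRHS]mulrN1 ler_pM2l ?subr_gt0//; lra.
rewrite expRN lef_pV2 ?posrE ?expR_gt0//.
by have := expR_ge1Dx (p - 1); rewrite subrKC.
Qed.

(** [q] bounds the quotient in the first factor: by Bernoulli, [(1 + theta) ^ p - 1 <= p theta + (p
    - 1) theta ^ 2]. The second factor uses [ln (1 + theta) <= theta]. *)
Lemma kfun_ge p theta q : 1 < p <= 2 -> 0 < theta < 1 ->
  2 * theta / (p - 1) + 2 * theta ^+ 2 <= q * (1 - theta) ^+ 2 -> q <= 1 ->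
  (1 - q) * expR ((p - 1) * (ln theta - 1 - theta)) <= kfun p theta.
Proof.
move=> /andP[p1 p2] /andP[t0 t1] hq q1; rewrite /kfun -/(weight p theta) weightE//.
have p0 : 0 < p by lra.
have s0 : 0 < p - 1 by lra.
apply: ler_pM; rewrite ?subr_ge0 ?expR_ge0//; last first.
  rewrite ler_expR ler_pM2l//.
  by have : ln (1 + theta) <= theta by [apply: le_ln1Dx; lra]; lra.
rewrite lerD2l lerN2.
have sq : 0 < (1 - theta) ^+ 2 by rewrite exprn_gt0// subr_gt0.
rewrite ler_pdivrMr; last by rewrite mulr_gt0// mulr_gt0.
have bern : (1 + theta) `^ p <= (1 + theta) * (1 + (p - 1) * theta).
  rewrite -(mulr_powRB1 (x := 1 + theta))//; last by lra.
  rewrite ler_pM2l; last by lra.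
  by apply: powR_add1_le; [apply/andP; split; lra|lra].
have : p * (p - 1) * (2 * theta / (p - 1) + 2 * theta ^+ 2) <=
    p * (p - 1) * (q * (1 - theta) ^+ 2) by rewrite ler_pM2l// mulr_gt0.
have -> : p * (p - 1) * (2 * theta / (p - 1) + 2 * theta ^+ 2) =
   2 * (p * theta) + 2 * (p * ((p - 1) * theta ^+ 2)).
  by field; rewrite gt_eqF.
have st : (p - 1) * theta ^+ 2 <= p * ((p - 1) * theta ^+ 2).
  by rewrite ler_peMl ?(ltW p1)// mulr_ge0 ?sqr_ge0// ltW.
by move: bern st; rewrite expr2; lra.
Qed.

Lemma Kbeckner_ge_onesub_inv p : 1 - p^-1 <= Kbeckner p.
Proof. by rewrite /Kbeckner le_max lexx. Qed.

(** The bound [kfun_le] ensures that [sup] is a true supremum and not the default value of an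
    unbounded set. *)
Lemma Kbeckner_ge_kfun p theta : 1 < p -> 0 < theta < 1 ->
  p / 2 * kfun p theta <= Kbeckner p.
Proof.
move=> p1 t01; rewrite /Kbeckner le_max; apply/orP; right.
rewrite ler_pM2l; last by rewrite divr_gt0//; lra.
apply: ub_le_sup; last by exists theta => //=; rewrite in_itv.
by exists p^-1 => _ [t /= + <-]; rewrite in_itv/= => /(kfun_le _ _ p1).
Qed.

Lemma Kbeckner_le_half p : 1 < p <= 2 -> Kbeckner p <= 2^-1.
Proof.
move=> /andP[p1 p2]; have p0 : 0 < p by lra.
rewrite /Kbeckner ge_max; apply/andP; split.
  have : 2^-1 <= p^-1 by rewrite lef_pV2 ?posrE.
  by lra.
apply: (@le_trans _ _ (p / 2 * p^-1)); last by rewrite mulrAC divff ?gt_eqF// mul1r.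
rewrite ler_pM2l ?divr_gt0//; apply: ge_sup.
  by exists (kfun p 2^-1); exists 2^-1 => //=; rewrite in_itv/=; apply/andP; split; lra.
by move=> _ [t /= + <-]; rewrite in_itv/= => /(kfun_le _ _ p1).
Qed.

Lemma Kbeckner_cvg2 : Kbeckner p @[p --> (2 : R)^'-] --> (2^-1 : R).
Proof.
apply: (@squeeze_cvgr _ _ _ _ (fun p : R => 1 - p^-1) (cst 2^-1)).
- near=> p; rewrite Kbeckner_ge_onesub_inv Kbeckner_le_half//.
  by apply/andP; split; near: p; [apply: nbhs_left_gt|apply: nbhs_left_le]; lra.
- have -> : (2^-1 : R) = 1 - 2^-1 by lra.
  apply: cvg_at_left_filter; apply: cvgB; first exact: cvg_cst.
  by apply: cvgV => //; rewrite gt_eqF.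
- exact: cvg_cst.
Unshelve. all: by end_near. Qed.

(** With [s = p - 1] and [theta = s ^ 2], the first factor is [1 - O(s)] and the exponent is of
    order [s ln s], controlled by the square root of [s]. *)
Lemma Kbeckner_ge_near1 p : 1 < p <= 9 / 8 ->
  2^-1 * (1 - 4 * Num.sqrt (p - 1) - 10 * (p - 1)) <= Kbeckner p.
Proof.
move=> /andP[p1 p2]; pose s := p - 1; pose r := Num.sqrt s.
have s0 : 0 < s by rewrite subr_gt0.
have s4 : s <= 1 / 8 by rewrite /s; lra.
have r0 : 0 < r by rewrite sqrtr_gt0.
have rs : r ^+ 2 = s by rewrite sqr_sqrtr// ltW.
have t01 : 0 < s ^+ 2 < 1 by rewrite exprn_gt0//= expr2; nra.
have p12 : 1 < p <= 2 by rewrite p1/=; lra.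
(* The left side is at most [4 s], and [(1 - s ^ 2) ^ 2 >= 1 / 2]; hence [q = 8 s]. *)
have hq : 2 * s ^+ 2 / (p - 1) + 2 * (s ^+ 2) ^+ 2 <= 8 * s * (1 - s ^+ 2) ^+ 2.
  rewrite -/s expr2 mulrA mulfK ?gt_eqF//.
  have ss : s * s <= 1 / 16 by nra.
  have : 2^-1 <= (1 - s * s) ^+ 2 by rewrite expr2; nra.
  have : (s * s) ^+ 2 <= s by rewrite expr2; nra.
  by nra.
have lns : 2 * (s - r) <= s * ln s.
  have -> : ln s = 2 * ln r by rewrite -rs lnXn// mulr_natl.
  have : s * (1 - r^-1) <= s * ln r by rewrite ler_pM2l ?ln_ge_onesub_inv.
  by rewrite mulrBr mulr1 -[in s / r]rs expr2 mulfK ?gt_eqF//; lra.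
have kge : 1 - 4 * r - 10 * s <= kfun p (s ^+ 2).
  have s18 : 8 * s <= 1 by lra.
  apply: le_trans (kfun_ge _ _ _ p12 t01 hq s18).
  rewrite -/s lnXn//.
  set x := s * _; have x0 : x <= 0.
    have lns0 : ln s <= 0 by apply: ln_le0; lra.
    by rewrite /x mulr_ge0_le0 ?(ltW s0)//; have := sqr_ge0 s; lra.
  have xge : - 4 * r - 2 * s <= x.
    have s3 : s * s ^+ 2 <= s by rewrite ler_piMr ?(ltW s0)//; case/andP: t01 => _ /ltW.
    by rewrite /x -mulr_natl; lra.
  have := expR_ge1Dx x; have : expR x <= 1 by rewrite expR_le1.
  have := expR_gt0 x; move: (expR x) => Y; nra.
have Kk := Kbeckner_ge_kfun p _ p1 t01.
(* Nonnegativity covers the case where the claimed lower bound is negative. *)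
have K0 : 0 <= Kbeckner p.
  apply: le_trans (Kbeckner_ge_onesub_inv p).
  by rewrite subr_ge0 invf_le1//; lra.
rewrite -/s -/r; nra.
Qed.

Lemma Kbeckner_cvg1 : Kbeckner p @[p --> (1 : R)^'+] --> (2^-1 : R).
Proof.
apply: (@squeeze_cvgr _ _ _ _
  (fun p : R => 2^-1 * (1 - 4 * Num.sqrt (p - 1) - 10 * (p - 1))) (cst 2^-1)).
- near=> p; apply/andP; split.
    apply: Kbeckner_ge_near1; apply/andP; split; near: p.
      exact: nbhs_right_gt.
    by apply: nbhs_right_le; lra.
  apply: Kbeckner_le_half; apply/andP; split; near: p.
    exact: nbhs_right_gt.
  by apply: nbhs_right_le; lra.
- have lim1 : 2^-1 * (1 - 4 * Num.sqrt (1 - 1) - 10 * (1 - 1)) = 2^-1 :> R.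
    by rewrite subrr sqrtr0; lra.
  rewrite -[X in _ --> X]lim1.
  have c1 : (p - 1 : R) @[p --> (1 : R)] --> (1 - 1 : R).
    by apply: cvgB => //; exact: cvg_cst.
  apply: cvg_at_right_filter; apply: cvgM; first exact: cvg_cst.
  apply: cvgB; last by apply: cvgM => //; exact: cvg_cst.
  apply: cvgB; first exact: cvg_cst.
  apply: cvgM; first exact: cvg_cst.
  by apply: (cvg_comp _ _ c1); exact: sqrt_continuous.
- exact: cvg_cst.
Unshelve. all: by end_near. Qed.

(** Iterated, this yields rational lower bounds on exponentials: start from [1 + z <= e ^ z] at
    [z = x / 2 ^ 7] and square seven times, rounding down to a short fraction each time. *)
Lemma expR_half_ge x a y : 0 <= a -> y <= a * a -> a <= expR (x / 2) -> y <= expR x.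
Proof.
move=> a0 ya ax; apply: le_trans ya _.
by rewrite [x in expR x](splitr x) expRD ler_pM.
Qed.

Lemma expR1_ge : 100 / 37 <= expR 1 :> R.
Proof.
apply: (expR_half_ge _ (686 / 417)); [lra..|].
apply: (expR_half_ge _ (59 / 46)); [lra..|].
apply: (expR_half_ge _ (94 / 83)); [lra..|].
apply: (expR_half_ge _ (895 / 841)); [lra..|].
apply: (expR_half_ge _ (816 / 791)); [lra..|].
apply: (expR_half_ge _ (842 / 829)); [lra..|].
apply: (expR_half_ge _ (1 + 1 / 2 / 2 / 2 / 2 / 2 / 2 / 2)); [lra..|].
exact: expR_ge1Dx.
Qed.

Lemma expRN_107_ge : 341 / 1000 <= expR (- (107 / 100)) :> R.
Proof.
apply: (expR_half_ge _ (386 / 661)); [lra..|].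
apply: (expR_half_ge _ (593 / 776)); [lra..|].
apply: (expR_half_ge _ (132 / 151)); [lra..|].
apply: (expR_half_ge _ (532 / 569)); [lra..|].
apply: (expR_half_ge _ (117 / 121)); [lra..|].
apply: (expR_half_ge _ (59 / 60)); [lra..|].
apply: (expR_half_ge _ (1 + - (107 / 100) / 2 / 2 / 2 / 2 / 2 / 2 / 2)); [lra..|].
exact: expR_ge1Dx.
Qed.

(** The term [1 - 1 / p] reaches [17 / 100] at [p = 100 / 83]; below that, [kfun] is evaluated at a
    single [theta]. *)
Lemma Kbeckner_ge_17 p : 1 < p <= 2 -> 17 / 100 <= Kbeckner p.
Proof.
move=> /andP[p1 p2]; have p0 : 0 < p by lra.
have [pbig|psmall] := leP (100 / 83) p.
  apply: le_trans (Kbeckner_ge_onesub_inv p).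
  have : p^-1 <= (100 / 83)^-1 by rewrite lef_pV2 ?posrE//; lra.
  by rewrite invf_div; lra.
pose s := p - 1; have s0 : 0 < s by rewrite subr_gt0.
have s83 : s <= 17 / 83 by rewrite /s; lra.
(* The supremum over [theta] is attained near [0.4 s ^ 2]. *)
pose c : R := expR (- 1); have c0 : 0 < c by exact: expR_gt0.
have c37 : c <= 37 / 100.
  by rewrite /c expRN -invf_div lef_pV2 ?posrE ?expR_gt0 ?expR1_ge//; lra.
pose theta := s ^+ 2 * c.
have theta0 : 0 < theta by rewrite mulr_gt0 ?exprn_gt0.
have theta_le : theta <= 37 / 100 * s * s by rewrite /theta expr2; nra.
have theta16 : theta <= 16 / 1000 by nra.
have t01 : 0 < theta < 1 by rewrite theta0/=; lra.
have p12 : 1 < p <= 2 by rewrite p1.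
(* The main term is [2 c s <= 0.74 s]; the margin up to 0.77 absorbs [theta ^ 2] and the factor
   [(1 - theta) ^ 2]. *)
have hq : 2 * theta / (p - 1) + 2 * theta ^+ 2 <= 77 / 100 * s * (1 - theta) ^+ 2.
  have -> : 2 * theta / (p - 1) = 2 * c * s.
    by rewrite -/s /theta; field; rewrite gt_eqF.
  have h1 : 968 / 1000 <= (1 - theta) ^+ 2 by rewrite expr2; nra.
  have h2 : theta ^+ 2 <= 16 / 1000 * (37 / 100 * s * s).
    by rewrite expr2; apply: ler_pM; rewrite // ltW.
  have h3 : s * s <= 17 / 83 * s by nra.
  have h4 : 77 / 100 * s * (968 / 1000) <= 77 / 100 * s * (1 - theta) ^+ 2.
    by rewrite ler_pM2l//; lra.
  by nra.
have q1 : 77 / 100 * s <= 1 by lra.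
have k := kfun_ge _ _ _ p12 t01 hq q1; move: k; rewrite -/s.
have lnt : ln theta = 2 * ln s - 1.
  by rewrite /theta lnM ?posrE ?exprn_gt0// lnXn// /c expRK mulr_natl.
pose s1 : R := expR (- (3 / 2)); have s10 : 0 < s1 by exact: expR_gt0.
have s1_le : s1 <= 226 / 1000.
  have : s1 ^+ 2 = c ^+ 3.
    by rewrite /s1 /c -!expRM_natl; congr expR; lra.
  rewrite !exprS !expr0 => h.
  have : c * (c * (c * 1)) <= 37 / 100 * (37 / 100 * (37 / 100)) by nra.
  by nra.
(* The tangent of [s ln s] at [s1 = e ^ (- 3 / 2)], which is close to [17 / 83]. *)
have slns : - (1 / 2) * s - s1 <= s * ln s.
  have : s * (1 - (s / s1)^-1) <= s * ln (s / s1).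
    by rewrite ler_pM2l// ln_ge_onesub_inv// divr_gt0.
  rewrite ln_div ?posrE// /s1 expRK -/s1 invf_div mulrBr [s * (s1 / s)]mulrCA divff ?gt_eqF//.
  by lra.
(* The exponent is at least [- 3 s - 2 s1 - s theta], about -1.07 at [s = 17 / 83]. *)
have expo : - (107 / 100) <= s * (ln theta - 1 - theta).
  by rewrite lnt; nra.
have expge : 341 / 1000 <= expR (s * (ln theta - 1 - theta)).
  by apply: le_trans expRN_107_ge _; rewrite ler_expR.
have Kk := Kbeckner_ge_kfun _ _ p1 t01.
move: expge; move: (expR _) => Y hY hk.
have hk' : (1 - 77 / 100 * s) * (341 / 1000) <= kfun p theta.
  by apply: le_trans hk; rewrite ler_pM2l//; lra.
apply: le_trans Kk.
(* Here [(1 + s) (1 - 0.77 s) >= 1] for [s <= 17 / 83], and [0.341 / 2 > 0.17]. *)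
apply: (@le_trans _ _ (p / 2 * ((1 - 77 / 100 * s) * (341 / 1000)))).
  have -> : p = 1 + s by rewrite /s subrKC.
  by nra.
by rewrite ler_pM2l ?divr_gt0.
Qed.

End constants.

Theorem theorem2p1 (d : measure_display) (X : measurableType d) (R : realType)
    (mu : probability X R) (Dom : set (X -> R))
    (E : (X -> R) -> (X -> R) -> R) (rho0 : R)
    (hE : nonneg_symmetric_form Dom E) (hA : assumptionA Dom E)
    (hrho0 : 0 < rho0) (hmlsi : mlsi mu Dom E rho0) :
  [/\ (forall p : R, 1 < p <= 2 ->
         exists2 alpha : R, Kbeckner p * rho0 <= alpha &
           beckner mu Dom E p alpha),
      Kbeckner p @[p --> (1 : R)^'+] --> (2^-1 : R),
      Kbeckner p @[p --> (2 : R)^'-] --> (2^-1 : R),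
      17 / 100 <= inf [set Kbeckner p | p in `]1, (2 : R)]%classic] &
      (forall p : R, 1 < p <= 2 ->
         exists2 alpha : R, rho0 / 6 <= alpha & beckner mu Dom E p alpha)].
Proof.
have half p : 1 < p <= 2 -> beckner mu Dom E p (rho0 / 2).
  by move=> p12; exact: beckner_half.
split; [|exact: Kbeckner_cvg1|exact: Kbeckner_cvg2| |].
- move=> p p12; exists (rho0 / 2); last exact: half.
  by rewrite mulrC ler_pM2l// Kbeckner_le_half.
- apply: lb_le_inf.
    by exists (Kbeckner 2); exists 2 => //=; rewrite in_itv/=; apply/andP; split; lra.
  by move=> _ [p /= + <-]; rewrite in_itv/=; exact: Kbeckner_ge_17.
- by move=> p p12; exists (rho0 / 2); [lra|exact: half].
Qed.
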